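(* Let $(X,s,m,A,\Phi)$, with root $x_\varnothing\in X$, be a right-visible growth system. Then there exist parameters $0<\theta<1$, $0<\kappa<1$ and $R>0$ such that: (a) For all $z\in\mathbb{C}$ with $|z|\le 1$ the operator $T_z$ is bounded and quasi-compact on $\mathcal{B}_{\theta,\kappa}$. (b) Let $w(x):=\theta^{m(x)}\kappa^{s(x)^2}$ and let $\mu_n:=(T_1^\ast)^n\delta_{x_\varnothing}\in\ell^1(X,w)$ be the element obtained by iterating the Banach adjoint $T_1^\ast$ of $T_1$ $n$ times from the Dirac mass $\delta_{x_\varnothing}$ at $x_\varnothing$. Then for every continuous linear functional $\Lambda$ on $\ell^1(X,w)$ the scalar series $$F_\Lambda(z):=\sum_{n\ge 0}\Lambda(\mu_n)\,z^n$$ has positive radius of convergence and is analytic for $|z|<R$.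
   Context: A right-visible growth system consists of: a countable set $X$ (state space) with a distinguished element $x_\varnothing\in X$ (root); functions $s,m:X\to\mathbb{N}$ (length and complexity, $\mathbb{N}\ni 0$); for each $x\in X$ a finite set $A(x)$ (admissible extensions); and a map $\Phi:\{(x,r):x\in X,\ r\in A(x)\}\to X$; such that (RV1) for each $L\in\mathbb{N}$ there are only finitely many $x\in X$ with $s(x)\le L$; (RV2) $s(\Phi(x,r))=s(x)+1$ for all $x\in X$, $r\in A(x)$; (RV3) $m(\Phi(x,r))\ge m(x)$ for all $x\in X$, $r\in A(x)$; (RV4) there exist constants $C_0,C_1\ge 0$ with $|A(x)|\le C_0+C_1 s(x)$ for all $x\in X$. For $0<\theta<1$, $0<\kappa<1$, $$\mathcal{B}_{\theta,\kappa}:=\Bigl\{f:X\to\mathbb{C}:\ \|f\|_{\theta,\kappa}:=\sup_{x\in X}\theta^{-m(x)}\kappa^{-s(x)^2}|f(x)|<\infty\Bigr\},$$ and for $z\in\mathbb{C}$, $(T_zf)(x):=z\sum_{r\in A(x)}f(\Phi(x,r))$. Quasi-compact here means: the essential spectral radius of the bounded operator is $<1$ (the sense in which any operator of the form finite rank plus strict contraction, i.e. operator norm $<1$, is quasi-compact). Let $\mathcal{B}^0_{\theta,\kappa}$ be the closed subspace of those $f\in\mathcal{B}_{\theta,\kappa}$ with $\theta^{-m(x)}\kappa^{-s(x)^2}|f(x)|\to 0$ as $s(x)\to\infty$; it is invariant under $T_1$. Its continuous dual is identified isometrically with $$\ell^1(X,w):=\Bigl\{\mu:X\to\mathbb{C}:\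 \|\mu\|_{1,w}:=\sum_{x\in X}|\mu(x)|w(x)<\infty\Bigr\},\qquad w(x)=\theta^{m(x)}\kappa^{s(x)^2},$$ via $\langle\mu,f\rangle=\sum_{x\in X}\mu(x)f(x)$. The adjoint $T_1^\ast:\ell^1(X,w)\to\ell^1(X,w)$ is defined by $\langle T_1^\ast\mu,f\rangle=\langle\mu,T_1f\rangle$ for all $f\in\mathcal{B}^0_{\theta,\kappa}$; explicitly $(T_1^\ast\mu)(y)=\sum_{x\in X,\ r\in A(x),\ \Phi(x,r)=y}\mu(x)$. The Dirac mass $\delta_{x_\varnothing}$ is the function equal to $1$ at $x_\varnothing$ and $0$ elsewhere. *)

(* Defs.v *)
From HB Require Import structures.
From mathcomp Require Import all_boot all_order all_algebra finmap complex.
From mathcomp Require Import all_classical all_reals all_analysis.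
From mathcomp.analysis.showcase Require summability.

Set Implicit Arguments.
Unset Strict Implicit.
Unset Printing Implicit Defensive.

Import Order.TTheory GRing.Theory Num.Theory.
Import numFieldNormedType.Exports.

Local Open Scope classical_set_scope.
Local Open Scope complex_scope.
Local Open Scope ring_scope.

(* MathComp-Analysis only puts a topology on the regular module [R[i]^o]. *)
HB.instance Definition _ (R : realType) := NormedModule.copy R[i] (R[i])^o.

(* The modulus as an element of [R]; [`|z|] is [(cmod z)%:C] by conversion. *)
Notation cmod := (@ComplexField.Normc.normc _).

Section CmodFacts.
Variable R : realType.
Implicit Types x y : R[i].

Lemma cmod_normE x : `|x| = (cmod x)%:C. Proof. by []. Qed.

Lemma cmod_ge0 x : 0 <= cmod x.
Proof. by rewrite -lecR; exact: (normr_ge0 x). Qed.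

Lemma cmodD x y : cmod (x + y) <= cmod x + cmod y.
Proof. by rewrite -lecR rmorphD/=; exact: (@ler_normD _ R[i]). Qed.

Lemma cmodM x y : cmod (x * y) = cmod x * cmod y.
Proof. exact: ComplexField.Normc.normcM. Qed.

Lemma cmod0 : cmod (0 : R[i]) = 0.
Proof. exact: ComplexField.Normc.normc0. Qed.

Lemma cmod0_eq0 x : cmod x = 0 -> x = 0.
Proof. exact: ComplexField.Normc.eq0_normc. Qed.

End CmodFacts.


Section WeightedSup.
Context {R : realType} {X : choiceType} (u : X -> {posnum R}).
Implicit Types f g : X -> R[i].

Definition wsup f : \bar R :=
  ereal_sup (range (fun x => ((u x)%:num * cmod (f x))%:E)).

Definition wsup_finite : {pred X -> R[i]} := mem [set f | (wsup f < +oo)%E].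

Record linf := Linf { linf_fun :> X -> R[i]; _ : linf_fun \in wsup_finite }.

Definition linf_norm (f : linf) : R := fine (wsup f).

Lemma wsup_ub f x : (((u x)%:num * cmod (f x))%:E <= wsup f)%E.
Proof. by apply: ereal_sup_ubound; exists x. Qed.

Lemma wsup_le f M : (forall x, (u x)%:num * cmod (f x) <= M) ->
  (wsup f <= M%:E)%E.
Proof. by move=> fM; apply: ge_ereal_sup => _ [x _ <-]; rewrite lee_fin. Qed.

Lemma wsup_finiteP f : reflect
  (exists M, forall x, (u x)%:num * cmod (f x) <= M) (f \in wsup_finite).
Proof.
apply: (iffP idP) => [|[M fM]]; rewrite inE /=; last first.
  exact: le_lt_trans (wsup_le fM) (ltry _).
have := wsup_ub f; case: (wsup f) => [M fM _|_ //|fM _].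
  by exists M => x; rewrite -lee_fin.
by exists 0 => x; have := fM x; rewrite leeNy_eq.
Qed.

HB.instance Definition _ := [isSub for linf_fun].
HB.instance Definition _ := [Choice of linf by <:].

Lemma wsup_finite_submod : submod_closed wsup_finite.
Proof.
split=> [|a f g /wsup_finiteP[M fM] /wsup_finiteP[N gN]]; apply/wsup_finiteP.
  by exists 0 => x; rewrite cmod0 mulr0.
exists (cmod a * M + N) => x.
have := lerD (ler_wpM2l (cmod_ge0 a) (fM x)) (gN x); apply: le_trans.
rewrite mulrCA -cmodM -mulrDr ler_wpM2l//; exact: cmodD.
Qed.

HB.instance Definition _ :=
  GRing.isSubmodClosed.Build _ _ wsup_finite wsup_finite_submod.
HB.instance Definition _ := [SubChoice_isSubLmodule of linf by <:].

Lemma linf_norm_ub (f : linf) x : (u x)%:num * cmod (f x) <= linf_norm f.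
Proof.
have := valP f; rewrite inE/= /linf_norm; have := wsup_ub f x.
by case: (wsup f) => //= r; rewrite lee_fin.
Qed.

Lemma linf_norm_le (f : linf) M : 0 <= M ->
  (forall x, (u x)%:num * cmod (f x) <= M) -> linf_norm f <= M.
Proof.
move=> M0 /wsup_le; rewrite /linf_norm.
by case: (wsup f) => //= r; rewrite lee_fin.
Qed.

Lemma linf_norm_ge0 (f : linf) : 0 <= linf_norm f.
Proof.
have [[x _]|X0] := pselect (exists x : X, True).
  by apply: le_trans (linf_norm_ub f x); rewrite mulr_ge0// cmod_ge0.
rewrite /linf_norm /wsup [X in ereal_sup X](_ : _ = set0) ?ereal_sup0//.
by apply/seteqP; split=> // y [x]; case: X0; exists x.
Qed.

Lemma linf_ler_normD (f g : linf) :
  (linf_norm (f + g))%:C <= (linf_norm f)%:C + (linf_norm g)%:C.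
Proof.
rewrite -rmorphD lecR; apply: linf_norm_le => [|x].
  by rewrite addr_ge0// linf_norm_ge0.
apply: le_trans (lerD (linf_norm_ub f x) (linf_norm_ub g x)).
by rewrite -mulrDr ler_wpM2l//; exact: cmodD.
Qed.

Lemma linf_normZ_le (a : R[i]) (f : linf) :
  linf_norm (a *: f) <= cmod a * linf_norm f.
Proof.
apply: linf_norm_le => [|x]; first by rewrite mulr_ge0 ?cmod_ge0 ?linf_norm_ge0.
rewrite (_ : (a *: f : linf) x = a * f x)// cmodM mulrCA.
by rewrite ler_wpM2l ?cmod_ge0// linf_norm_ub.
Qed.

Lemma linf_normrZ (a : R[i]) (f : linf) :
  (linf_norm (a *: f))%:C = `|a| * (linf_norm f)%:C.
Proof.
rewrite cmod_normE -rmorphM; congr (_%:C).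
apply/eqP; rewrite eq_le linf_normZ_le/=.
have [->|a0] := eqVneq a 0; first by rewrite cmod0 mul0r linf_norm_ge0.
have ca0 : 0 < cmod a.
  by rewrite lt_def cmod_ge0 andbT; apply: contra_neq a0 => /cmod0_eq0.
have := linf_normZ_le a^-1 (a *: f); rewrite scalerA mulVf// scale1r.
by rewrite ComplexField.Normc.normcV ler_pdivlMl.
Qed.

Lemma linf_norm0_eq0 (f : linf) : (linf_norm f)%:C = 0 -> f = 0.
Proof.
move=> /(congr1 (@complex.Re _))/= f0; apply/val_inj/funext => x.
apply/cmod0_eq0/eqP; rewrite eq_le cmod_ge0 andbT.
by have := linf_norm_ub f x; rewrite f0 pmulr_rle0.
Qed.

HB.instance Definition _ := Lmodule_isNormed.Build R[i] linf
  linf_ler_normD linf_normrZ linf_norm0_eq0.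

End WeightedSup.

Section WeightedL1.
Context {R : realType} {X : choiceType} (w : X -> {posnum R}).
Implicit Types f g : X -> R[i].

Definition wsum f : \bar R :=
  (\esum_(x in [set: X]) (cmod (f x) * (w x)%:num)%:E)%E.

Definition wsum_finite : {pred X -> R[i]} := mem [set f | (wsum f < +oo)%E].

Record ell1 := Ell1 { ell1_fun :> X -> R[i]; _ : ell1_fun \in wsum_finite }.

Definition ell1_norm (f : ell1) : R := fine (wsum f).

Lemma wterm_ge0 f x : (0 <= (cmod (f x) * (w x)%:num)%:E)%E.
Proof. by rewrite lee_fin mulr_ge0// cmod_ge0. Qed.

Lemma wsum_ge0 f : (0 <= wsum f)%E.
Proof. by apply: esum_ge0 => x _; exact: wterm_ge0. Qed.

Lemma wsum_ub f x : ((cmod (f x) * (w x)%:num)%:E <= wsum f)%E.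
Proof.
apply: esum_ge; exists [set x]; first by split.
by rewrite fsbig_set1.
Qed.

Lemma wsumD f g : (wsum (f + g)%R <= wsum f + wsum g)%E.
Proof.
rewrite /wsum -esumD; [|by move=> *; exact: wterm_ge0..].
apply: le_esum => x _; rewrite -EFinD lee_fin -mulrDl ler_wpM2r//.
exact: cmodD.
Qed.

Lemma wsumZ_le a f : (wsum (a *: f)%R <= (cmod a)%:E * wsum f)%E.
Proof.
apply: ge_ereal_sup => _ [F [finF _] <-].
rewrite (eq_fsbigr (fun x =>
  (cmod a)%:E * (cmod (f x) * (w x)%:num)%:E)%E) => [|x _]; last first.
  by rewrite (_ : (a *: f) x = a * f x)// cmodM -mulrA EFinM.
rewrite -ge0_mule_fsumr; last by move=> x; exact: wterm_ge0.
apply: lee_wpmul2l; first by rewrite lee_fin cmod_ge0.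
by apply: esum_ge; exists F.
Qed.

HB.instance Definition _ := [isSub for ell1_fun].
HB.instance Definition _ := [Choice of ell1 by <:].

Lemma wsum0 : wsum 0 = 0%E.
Proof. by apply: esum1 => x _; rewrite cmod0 mul0r. Qed.

Lemma wsum_finite_submod : submod_closed wsum_finite.
Proof.
split=> [|a f g]; rewrite !inE/=; first by rewrite wsum0 ltry.
move=> fo go; apply: le_lt_trans (wsumD _ _) _; rewrite lte_add_pinfty//.
apply: le_lt_trans (wsumZ_le _ _) _.
by rewrite lte_mul_pinfty// lee_fin cmod_ge0.
Qed.

HB.instance Definition _ :=
  GRing.isSubmodClosed.Build _ _ wsum_finite wsum_finite_submod.
HB.instance Definition _ := [SubChoice_isSubLmodule of ell1 by <:].

Lemma ell1_normE (f : ell1) : ((ell1_norm f)%:E = wsum f)%E.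
Proof.
have := valP f; rewrite inE/= => fo.
by rewrite /ell1_norm fineK// ge0_fin_numE// wsum_ge0.
Qed.

Lemma ell1_ler_normD (f g : ell1) :
  (ell1_norm (f + g))%:C <= (ell1_norm f)%:C + (ell1_norm g)%:C.
Proof. by rewrite -rmorphD lecR -lee_fin EFinD !ell1_normE wsumD. Qed.

Lemma ell1_normZ_le (a : R[i]) (f : ell1) :
  ell1_norm (a *: f) <= cmod a * ell1_norm f.
Proof. by rewrite -lee_fin EFinM !ell1_normE wsumZ_le. Qed.

Lemma ell1_norm_ge0 (f : ell1) : 0 <= ell1_norm f.
Proof. by rewrite -lee_fin ell1_normE wsum_ge0. Qed.

Lemma ell1_normrZ (a : R[i]) (f : ell1) :
  (ell1_norm (a *: f))%:C = `|a| * (ell1_norm f)%:C.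
Proof.
rewrite cmod_normE -rmorphM; congr (_%:C).
apply/eqP; rewrite eq_le ell1_normZ_le/=.
have [->|a0] := eqVneq a 0; first by rewrite cmod0 mul0r ell1_norm_ge0.
have ca0 : 0 < cmod a.
  by rewrite lt_def cmod_ge0 andbT; apply: contra_neq a0 => /cmod0_eq0.
have := ell1_normZ_le a^-1 (a *: f); rewrite scalerA mulVf// scale1r.
by rewrite ComplexField.Normc.normcV ler_pdivlMl.
Qed.

Lemma ell1_norm0_eq0 (f : ell1) : (ell1_norm f)%:C = 0 -> f = 0.
Proof.
move=> /(congr1 (@complex.Re _))/= f0; apply/val_inj/funext => x.
apply/cmod0_eq0/eqP; rewrite eq_le cmod_ge0 andbT.
by have := wsum_ub f x; rewrite -ell1_normE f0 lee_fin pmulr_lle0.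
Qed.

HB.instance Definition _ := Lmodule_isNormed.Build R[i] ell1
  ell1_ler_normD ell1_normrZ ell1_norm0_eq0.

Lemma dirac_wsum_finite (a : X) :
  (fun x => (x == a)%:R : R[i]) \in wsum_finite.
Proof.
rewrite inE/= /wsum.
rewrite (_ : esum _ _ =
    (\esum_(x in [set a]) (cmod (1 : R[i]) * (w x)%:num)%:E)%E); last first.
  rewrite [RHS]esum_mkcond; apply: eq_esum => x _; rewrite in_set1.
  by case: eqP => // _; rewrite cmod0 mul0r.
by rewrite esum_set1 ?ltry// lee_fin mulr_ge0// cmod_ge0.
Qed.

Definition dirac_mass (a : X) : ell1 := Ell1 (dirac_wsum_finite a).

End WeightedL1.

(* Unordered sum over [X] (limit over the finite subsets of [X]). *)
Definition pairing (R : realType) (X : choiceType) (mu f : X -> R[i]) : R[i] :=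
  summability.sum (fun x => mu x * f x).

Section Operators.
Context {R : realType} {V : normedModType R[i]}.
Implicit Types (T : V -> V) (S : set V).

Definition bounded_operator T :=
  exists M : R, forall v, `|T v| <= M%:C * `|v|.

Definition finite_dim S := exists (n : nat) (e : 'I_n -> V),
  (forall i, S (e i)) /\
  (forall v, S v -> exists c : 'I_n -> R[i], v = \sum_(i < n) c i *: e i).

Definition finite_codim S := exists (n : nat) (e : 'I_n -> V),
  forall v, exists (c : 'I_n -> R[i]) (u : V),
    S u /\ v = u + \sum_(i < n) c i *: e i.

Definition fredholm T := [/\ finite_dim [set v | T v = 0],
  closed (range T) & finite_codim (range T)].

(* Fredholm essential spectrum; the other usual essential spectra (Calkin,
   Browder) have the same radius. *)
Definition ess_spectrum T : set R[i] :=
  [set l | ~ fredholm (fun v => T v - l *: v)].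

(* [maxe 0] makes the radius 0 when the essential spectrum is empty. *)
Definition ess_spectral_radius T : \bar R :=
  maxe 0%E (ereal_sup [set (cmod l)%:E | l in ess_spectrum T]).

Definition quasi_compact T := (ess_spectral_radius T < 1%:E)%E.

End Operators.

Section PowerSeries.
Context {R : realType}.
Implicit Types (c : nat -> R[i]) (U : set R[i]).

Definition power_series c (z : R[i]) : R[i] ^nat := [series c n * z ^+ n]_n.

Definition power_series_sum c (z : R[i]) : R[i] := limn (power_series c z).

Definition convergence_radius c : \bar R :=
  ereal_sup [set (cmod z)%:E | z in [set z | cvgn (power_series c z)]].

Definition analytic_on U (F : R[i] -> R[i]) :=
  forall z0, U z0 -> exists (a : nat -> R[i]) (r : R), 0 < r /\
    forall z, `|z - z0| < r%:C -> power_series a (z - z0) @ \oo --> F z.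

End PowerSeries.

Record growth_system (R : realType) := GrowthSystem {
  gs_state : countType;
  gs_root : gs_state;
  gs_len : gs_state -> nat;
  gs_cplx : gs_state -> nat;
  gs_adm : gs_state -> finType;
  gs_ext : forall x : gs_state, gs_adm x -> gs_state;
  gs_rv1 : forall L : nat, finite_set [set x | (gs_len x <= L)%N];
  gs_rv2 : forall x (r : gs_adm x), gs_len (gs_ext r) = (gs_len x).+1;
  gs_rv3 : forall x (r : gs_adm x), (gs_cplx x <= gs_cplx (gs_ext r))%N;
  gs_rv4 : exists C0 C1 : R, [/\ 0 <= C0, 0 <= C1 &
    forall x, #|gs_adm x|%:R <= C0 + C1 * (gs_len x)%:R]
}.

Section TransferOperator.
Context {R : realType} (G : growth_system R).
Implicit Types (theta kappa : {posnum R}) (f : gs_state G -> R[i]).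

Definition transfer (z : R[i]) f : gs_state G -> R[i] :=
  fun x => z * \sum_(r : gs_adm x) f (gs_ext r).

Definition sup_weight theta kappa (x : gs_state G) : {posnum R} :=
  (theta%:num ^- gs_cplx x * kappa%:num ^- (gs_len x ^ 2))%:pos.

Definition ell1_weight theta kappa (x : gs_state G) : {posnum R} :=
  (theta%:num ^+ gs_cplx x * kappa%:num ^+ (gs_len x ^ 2))%:pos.

Definition Bspace theta kappa := linf (sup_weight theta kappa).

Definition Bspace0 theta kappa : set (Bspace theta kappa) :=
  [set f | forall e : R, 0 < e -> exists N : nat, forall x : gs_state G,
     (N <= gs_len x)%N -> (sup_weight theta kappa x)%:num * cmod (f x) < e].

Definition L1space theta kappa := ell1 (ell1_weight theta kappa).

(* Adjoint of [transfer 1] on the closed subspace [Bspace0], whose dual is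
   [L1space] through [pairing]; finitely supported functions belong to
   [Bspace0], so this identity determines [Tadj]. *)
Definition is_adjoint theta kappa
    (Tadj : L1space theta kappa -> L1space theta kappa) :=
  forall (mu : L1space theta kappa) (f : Bspace theta kappa),
    Bspace0 f -> pairing (Tadj mu) f = pairing mu (transfer 1 f).

End TransferOperator.

(* Main.v *)
From HB Require Import structures.
Require Import Defs.
From mathcomp Require Import all_boot all_order all_algebra finmap complex.
From mathcomp Require Import all_classical all_reals all_analysis.
From mathcomp.analysis.showcase Require summability.
From mathcomp Require Import lra.
Import Order.TTheory GRing.Theory Num.Theory numFieldNormedType.Exports.
Local Open Scope classical_set_scope.
Local Open Scope complex_scope.
Local Open Scope ring_scope.

Set Implicit Arguments.
Unset Strict Implicit.
Unset Printing Implicit Defensive.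

(** Take [theta = 1/2] and [kappa] so small that
    [(C0 + C1) kappa <= 1/2].  Passing from [x] to an extension raises [s^2] by
    [2 s + 1], and the factor [kappa^(2 s + 1)] beats the linear bound on the
    number of extensions: the weight of all extensions of [x] together is at
    most half the weight of [x].  So [T_z] is a strict contraction of norm at
    most [1/2] for [|z| <= 1], and [T_z - l] is bijective for [|l| > 1/2].
    The same inequality shows that the adjoint halves the [ell^1] norm,
    whence [Lambda (mu_n) = O(2^-n)] and the series converges for [|z| < 1]. *)

(** * Complex sequences *)

Section ComplexModulus.
Context {R : realType}.
Implicit Types (x y z : R[i]) (u : nat -> R[i]) (e : nat -> R).

Lemma cmodN x : cmod (- x) = cmod x.
Proof. by apply: complexI; rewrite -!cmod_normE normrN. Qed.

Lemma cmodB x y : cmod (x - y) = cmod (y - x).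
Proof. by rewrite -cmodN opprB. Qed.

Lemma cmod1 : cmod (1 : R[i]) = 1.
Proof. by apply: complexI; rewrite -cmod_normE normr1. Qed.

Lemma cmodX x n : cmod (x ^+ n) = cmod x ^+ n.
Proof. by elim: n => [|n ih]; rewrite ?cmod1// !exprS cmodM ih. Qed.

Lemma cmod_real (a : R) : cmod a%:C = `|a|.
Proof. by rewrite /ComplexField.Normc.normc /= expr0n addr0 sqrtr_sqr. Qed.

Lemma cmod_nat n : cmod (n%:R : R[i]) = n%:R.
Proof. by rewrite -(rmorph_nat (real_complex R)) cmod_real normr_nat. Qed.

Lemma ler_cmod_sum (I : Type) (r : seq I) (P : pred I) (F : I -> R[i]) :
  cmod (\sum_(i <- r | P i) F i) <= \sum_(i <- r | P i) cmod (F i).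
Proof.
elim/big_ind2: _ => [|x1 x2 y1 y2 h1 h2|//]; first by rewrite cmod0.
exact: le_trans (cmodD _ _) (lerD h1 h2).
Qed.

Lemma cmod_le_ReIm z : cmod z <= `|complex.Re z| + `|complex.Im z|.
Proof.
case: z => a b /=; rewrite -[X in _ <= X]ger0_norm ?addr_ge0// -sqrtr_sqr.
rewrite ler_wsqrtr// sqrrD !real_normK ?num_real//.
by rewrite addrAC lerDl mulrn_wge0// mulr_ge0.
Qed.

Lemma Re_le_cmod z : `|complex.Re z| <= cmod z.
Proof. by rewrite -lecR; exact: normc_ge_Re. Qed.

Lemma Im_le_cmod z : `|complex.Im z| <= cmod z.
Proof.
by case: z => a b /=; rewrite -sqrtr_sqr ler_wsqrtr// lerDr sqr_ge0.
Qed.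

Lemma posc_real (e : R[i]) : 0 < e -> exists2 d : R, 0 < d & e = d%:C.
Proof.
by case: e => a b; rewrite ltcE/= => /andP[/eqP -> a0]; exists a.
Qed.

Lemma cvg_cmod (T : Type) (F : set_system T) (FF : Filter F)
    (f : T -> R[i]) l :
  (forall e : R, 0 < e -> \forall t \near F, cmod (f t - l) <= e) ->
  f @ F --> l.
Proof.
move=> fl; apply/cvgrPdist_le => e /posc_real[d d0 ->].
by apply: filterS (fl d d0) => t; rewrite -lecR cmodB.
Qed.

Lemma nonincreasing_cvg0_ge0 e : nonincreasing_seq e -> e @ \oo --> 0 ->
  forall n, 0 <= e n.
Proof.
move=> en e0 n; have cve : cvgn e by apply/cvg_ex; exists 0.
by have := nonincreasing_cvgn_ge en cve n; rewrite (cvg_lim _ e0).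
Qed.

(** The sequence [u + e] decreases and [u - e] increases, and both tend to the limit of [u], which
    they therefore enclose at every [n]. *)
Lemma real_cvg_steps (u e : nat -> R) :
  (forall n, `|u n.+1 - u n| <= e n - e n.+1) -> e @ \oo --> 0 ->
  exists l, forall n, `|l - u n| <= e n.
Proof.
move=> ue e0.
have down : nonincreasing_seq (u \+ e).
  apply/nonincreasing_seqP => n /=; have := ue n.
  by rewrite ler_norml => /andP[]; lra.
have up : nondecreasing_seq (u \- e).
  apply/nondecreasing_seqP => n /=; have := ue n.
  by rewrite ler_norml => /andP[]; lra.
have e_ge0 n : 0 <= e n.
  apply: nonincreasing_cvg0_ge0 e0 n; apply/nonincreasing_seqP => k.
  by rewrite -subr_ge0; exact: le_trans (ue k).
have cv : cvgn (u \- e).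
  apply: nondecreasing_is_cvgn => //; exists ((u \+ e) 0%N) => _ [n _ <-] /=.
  by have /= := down 0%N n (leq0n n); have := e_ge0 n; lra.
have cve : cvgn e by apply/cvg_ex; exists 0.
have cvu : cvgn u.
  have -> : u = (u \- e) \+ e by apply/funext => n /=; rewrite subrK.
  exact: is_cvgD.
have lE : limn (u \- e) = limn u.
  by rewrite limB// (cvg_lim _ e0)// subr0.
have lE' : limn (u \+ e) = limn u.
  by rewrite limD// (cvg_lim _ e0)// addr0.
have cvue : cvgn (u \+ e) by exact: is_cvgD.
exists (limn u) => n; rewrite ler_norml.
have := nondecreasing_cvgn_le up cv n.
have := nonincreasing_cvgn_ge down cvue n.
rewrite lE lE' /= => h1 h2; apply/andP; split; lra.
Qed.

(** Real and imaginary parts each converge with error [e n]; adding the two errors gives the factor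
    2. *)
Lemma cmod_cvg_steps u e :
  (forall n, cmod (u n.+1 - u n) <= e n - e n.+1) -> e @ \oo --> 0 ->
  exists l, forall n, cmod (l - u n) <= e n *+ 2.
Proof.
move=> ue e0.
have [|a ua] := @real_cvg_steps (fun n => complex.Re (u n)) e _ e0.
  move=> n; apply: le_trans (ue n); have := Re_le_cmod (u n.+1 - u n).
  by rewrite raddfB.
have [|b ub] := @real_cvg_steps (fun n => complex.Im (u n)) e _ e0.
  move=> n; apply: le_trans (ue n); have := Im_le_cmod (u n.+1 - u n).
  by rewrite raddfB.
exists (a +i* b) => n; apply: le_trans (cmod_le_ReIm _) _.
by rewrite !raddfB/= mulr2n lerD.
Qed.

Lemma cvg_geo (a q : R) : 0 <= q -> q < 1 -> (fun n => a * q ^+ n) @ \oo --> 0.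
Proof.
move=> q0 q1; rewrite -[0](mulr0 a); apply: cvgMr; apply: cvg_expr.
by rewrite ger0_norm.
Qed.

(** Serves to discard an error that depends on an auxiliary index absent from [x] and [a]. *)
Lemma le_geo0 (x a b q : R) : 0 <= q -> q < 1 ->
  (forall n, x <= a + b * q ^+ n) -> x <= a.
Proof.
move=> q0 q1 xab; have bq0 := cvg_geo b q0 q1.
have cv : (fun n => a + b * q ^+ n) @ \oo --> a.
  rewrite -[X in _ --> X]addr0; apply: cvgD => //; exact: cvg_cst.
rewrite -(cvg_lim _ cv)//; apply: limr_ge; first by apply/cvg_ex; exists a.
exact: nearW.
Qed.

(** With [D = C / (1 - q)], the step bound [C * q ^+ n] is the difference
    [D * q ^+ n - D * q ^+ n.+1]. *)
Lemma cmod_cvg_geo u (C q : R) : 0 <= q -> q < 1 ->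
  (forall n, cmod (u n.+1 - u n) <= C * q ^+ n) ->
  exists l, forall n, cmod (l - u n) <= C / (1 - q) *+ 2 * q ^+ n.
Proof.
move=> q0 q1 uC; have q1' : 1 - q != 0 by rewrite subr_eq0 gt_eqF.
have [|l ul] := @cmod_cvg_steps u _ _ (cvg_geo (C / (1 - q)) q0 q1).
  move=> n; apply: le_trans (uC n) _; rewrite exprS mulrA -mulrBl.
  by rewrite -[X in X - _]mulr1 -mulrBr mulfVK.
by exists l => n; rewrite mulrnAl.
Qed.

Lemma cvg_cmod_geo u l (C q : R) : 0 <= q -> q < 1 ->
  (forall n, cmod (l - u n) <= C * q ^+ n) -> u @ \oo --> l.
Proof.
move=> q0 q1 uC; apply: cvg_cmod => e e0.
have /cvgrPdist_le/(_ e e0) := cvg_geo C q0 q1; apply: filterS => n.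
rewrite sub0r normrN cmodB => h; apply: le_trans (uC n) _.
exact: le_trans (ler_norm _) h.
Qed.

End ComplexModulus.

(** * Power series and their expansion about another centre *)

Section PowerSeries.
Context {R : realType}.
Implicit Types (c : nat -> R[i]) (z : R[i]).

Lemma power_seriesE c z N :
  power_series c z N = \sum_(0 <= k < N) c k * z ^+ k.
Proof. by rewrite /power_series /series. Qed.

Lemma power_series_cvg c z (C q : R) : 0 <= q -> q < 1 ->
  (forall n, cmod (c n * z ^+ n) <= C * q ^+ n) ->
  exists l, forall n,
    cmod (l - power_series c z n) <= C / (1 - q) *+ 2 * q ^+ n.
Proof.
move=> q0 q1 cC; apply: cmod_cvg_geo => // n.
by rewrite !power_seriesE big_nat_recr//= addrAC subrr add0r.
Qed.

(** The moduli of the terms form a tail of the binomial expansion of [(cmod x + cmod y) ^+ n], whose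
    terms are all nonnegative. *)
Lemma cmod_binomial_le x y n (K : nat) :
  (K <= n.+1)%N -> cmod x + cmod y <= 1 ->
  cmod (\sum_(K <= k < n.+1) 'C(n, k)%:R * x ^+ (n - k) * y ^+ k : R[i]) <= 1.
Proof.
move=> Kn xy1; apply: le_trans (ler_cmod_sum _ _ _) _.
apply: (@le_trans _ _ ((cmod x + cmod y) ^+ n)); last first.
  by rewrite exprn_ile1// addr_ge0// cmod_ge0.
rewrite exprDn -(big_mkord xpredT
  (fun i => cmod x ^+ (n - i) * cmod y ^+ i *+ 'C(n, i))).
rewrite [leRHS](big_cat_nat (n := K))//= ler_wpDl//.
  apply: sumr_ge0 => i _; rewrite mulrn_wge0// mulr_ge0//.
    by rewrite exprn_ge0 ?cmod_ge0.
  by rewrite exprn_ge0 ?cmod_ge0.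
apply: ler_sum => i _.
by rewrite !cmodM !cmodX cmod_nat -mulrA mulr_natl.
Qed.

(** For [n < K] the truncation contains the whole expansion, the surplus binomials being 0, so the
    error vanishes. Otherwise it is a binomial tail. *)
Lemma cmod_pow_recenter_le (z0 h : R[i]) n K : cmod z0 + cmod h <= 1 ->
  cmod ((z0 + h) ^+ n - \sum_(0 <= k < K) 'C(n, k)%:R * z0 ^+ (n - k) * h ^+ k)
    <= (K <= n)%:R.
Proof.
move=> zh.
have -> : (z0 + h) ^+ n =
    \sum_(0 <= k < n.+1) 'C(n, k)%:R * z0 ^+ (n - k) * h ^+ k.
  by rewrite exprDn big_mkord; apply: eq_bigr => i _; rewrite -mulrA mulr_natl.
have [Kn|nK] := leqP K n.
  rewrite (big_cat_nat (n := K))//= ?leqW// addrAC subrr add0r.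
  by apply: cmod_binomial_le => //; exact: leqW.
rewrite [X in _ - X](big_cat_nat (n := n.+1))//= opprD addrA subrr add0r.
rewrite big_nat big1 ?oppr0 ?cmod0// => i /andP[ni _].
by rewrite bin_small// !mul0r.
Qed.

Lemma sum_half_tail K M :
  \sum_(0 <= n < K + M) (K <= n)%:R * (2^-1 : R) ^+ n <= 2 * 2^-1 ^+ K.
Proof.
rewrite (big_cat_nat (n := K)) ?leq_addr//= big_nat big1 ?add0r; last first.
  by move=> i /andP[_ iK]; rewrite leqNgt iK mul0r.
(* From [K] on, [2^-1 ^+ n] is the increment of [- 2 * 2^-1 ^+ n], so the sum telescopes. *)
rewrite (eq_big_nat _ _ (F2 := fun n : nat =>
    (- 2 * 2^-1 ^+ n.+1) - (- 2 * 2^-1 ^+ n))); last first.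
  by move=> i /andP[Ki _]; rewrite Ki exprS mul1r; lra.
rewrite telescope_sumr ?leq_addr//.
have : 0 <= (2^-1 : R) ^+ (K + M) by rewrite exprn_ge0.
lra.
Qed.

(* Truncating both expansions at finite level leaves only the binomial terms
   with [K <= k <= n], so no interchange of infinite sums is needed. *)
Lemma power_series_recenter c (C : R) z0 (r : R) :
  (forall n, cmod (c n) <= C * 2^-1 ^+ n) -> 0 < r -> cmod z0 + r <= 1 ->
  exists a : nat -> R[i], forall h, cmod h < r ->
    power_series a h @ \oo --> power_series_sum c (z0 + h).
Proof.
move=> cC r0 z0r.
have half0 : 0 <= (2^-1 : R) by [].
have half1 : (2^-1 : R) < 1 by lra.
have C0 : 0 <= C.
  have := cC 0%N; rewrite expr0 mulr1; apply: le_trans; exact: cmod_ge0.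
(* The contribution of [c n * (z0 + h) ^+ n] to the coefficient of [h ^+ k]; for [k > n] the
   binomial makes it 0. *)
pose b k n := c n * ('C(n, k)%:R * z0 ^+ (n - k)).
have bC k n : cmod (b k n) <= C / r ^+ k * 2^-1 ^+ n.
  rewrite mulrAC ler_pdivlMr ?exprn_gt0//.
  have [kn|nk] := leqP k n; last first.
    by rewrite /b bin_small// mul0r mulr0 cmod0 mul0r mulr_ge0// exprn_ge0.
  rewrite cmodM -mulrA; apply: le_trans (_ : cmod (c n) * 1 <= _); last first.
    by rewrite mulr1.
  apply: ler_wpM2l; first exact: cmod_ge0.
  (* A Cauchy-type estimate: ['C(n, k) * cmod z0 ^+ (n - k) * r ^+ k] is a single term of this
     power. *)
  have : (cmod z0 + r) ^+ n <= 1.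
    by rewrite exprn_ile1// addr_ge0 ?cmod_ge0// ltW.
  apply: le_trans; rewrite exprDn (bigD1 (Ordinal (kn : k < n.+1)%N))//=.
  rewrite cmodM cmodX cmod_nat -mulrA mulr_natl lerDl.
  apply: sumr_ge0 => i _; rewrite mulrn_wge0// mulr_ge0//.
    by rewrite exprn_ge0 ?cmod_ge0.
  by rewrite exprn_ge0 ?ltW.
(* The new coefficient [a k] is the sum of [b k n] over all [n], with a geometric rate depending on
   [k]. *)
have /choice[a aP] k : exists l, forall N,
    cmod (l - \sum_(0 <= n < N) b k n) <=
      C / r ^+ k / (1 - 2^-1) *+ 2 * 2^-1 ^+ N.
  apply: cmod_cvg_geo => // n.
  by rewrite big_nat_recr//= addrAC subrr add0r.
exists a => h hr.
have zh : cmod z0 + cmod h <= 1 by lra.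
have [|F FP] := @power_series_cvg c (z0 + h) C 2^-1 half0 half1.
  move=> n; rewrite cmodM cmodX; apply: le_trans (cC n).
  apply: ler_piMr; first exact: cmod_ge0.
  apply: exprn_ile1; first exact: cmod_ge0.
  exact: le_trans (cmodD _ _) zh.
rewrite /power_series_sum (cvg_lim _ (cvg_cmod_geo half0 half1 FP)); last first.
  exact: norm_hausdorff.
apply: (@cvg_cmod_geo _ _ _ (C * 2) 2^-1) => // K.
(* [B] collects the constants in the errors from cutting the sums over [n] at [K + M]: one for [F],
   and one for each [a k] with [k < K]. It does not depend on [M], so letting [M] grow leaves only
   [C * 2 * 2^-1 ^+ K]. *)
pose B := (C / (1 - 2^-1) *+ 2) +
  \sum_(0 <= k < K) (C / r ^+ k / (1 - 2^-1) *+ 2) * cmod h ^+ k.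
have B0 : 0 <= B.
  have h2 : 0 <= 1 - (2^-1 : R) by lra.
  rewrite addr_ge0 ?mulrn_wge0 ?divr_ge0// sumr_ge0// => i _.
  rewrite mulr_ge0 ?exprn_ge0 ?cmod_ge0// mulrn_wge0// !divr_ge0//.
  by rewrite exprn_ge0// ltW.
apply: (@le_geo0 _ _ _ B 2^-1) => // M.
apply: (@le_trans _ _ (C * 2 * 2^-1 ^+ K + B * 2^-1 ^+ (K + M))); last first.
  rewrite lerD2l ler_wpM2l// exprD ler_piMl ?exprn_ge0//.
  by rewrite exprn_ile1// ltW.
set N := (K + M)%N.
(* [P] is cut in both indices. The three differences below are the tail of [F], the discarded
   binomial terms with [K <= k <= n], and the tails of the [a k]. *)
pose P := \sum_(0 <= k < K) (\sum_(0 <= n < N) b k n) * h ^+ k.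
have -> : F - power_series a h K = (F - power_series c (z0 + h) N) +
    ((power_series c (z0 + h) N - P) + (P - power_series a h K)).
  by rewrite !addrA !subrK.
apply: le_trans (cmodD _ _) _; rewrite [B * _]mulrDl [leRHS]addrCA.
apply: lerD; first exact: FP.
apply: le_trans (cmodD _ _) _; apply: lerD.
  have -> : power_series c (z0 + h) N - P = \sum_(0 <= n < N) c n *
     ((z0 + h) ^+ n - \sum_(0 <= k < K) 'C(n, k)%:R * z0 ^+ (n - k) * h ^+ k).
    rewrite power_seriesE /P.
    under [X in _ - X]eq_bigr do rewrite mulr_suml.
    rewrite exchange_big/= -sumrB; apply: eq_bigr => n _.
    rewrite mulrBr mulr_sumr; congr (_ - _); apply: eq_bigr => k _.
    by rewrite /b !mulrA.
  apply: le_trans (ler_cmod_sum _ _ _) _.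
  rewrite -mulrA; apply: le_trans (ler_wpM2l C0 (sum_half_tail K M)).
  rewrite mulr_sumr; apply: ler_sum => n _; rewrite cmodM mulrCA mulrC.
  by apply: ler_pM => //; rewrite ?cmod_ge0//; exact: cmod_pow_recenter_le.
rewrite power_seriesE /P -sumrB; apply: le_trans (ler_cmod_sum _ _ _) _.
rewrite mulr_suml; apply: ler_sum => k _.
rewrite -mulrBl cmodM cmodB cmodX mulrAC ler_wpM2r//.
by rewrite exprn_ge0 ?cmod_ge0.
Qed.

End PowerSeries.
(** * Contractions of a weighted sup space *)

Section LinfContraction.
Context {R : realType} {X : choiceType} (u : X -> {posnum R}).
Implicit Types f g : linf u.

Lemma linf_normE f : `|f| = (linf_norm f)%:C. Proof. by []. Qed.

Lemma linf_normD f g : linf_norm (f + g) <= linf_norm f + linf_norm g.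
Proof. by rewrite -lecR rmorphD; exact: linf_ler_normD. Qed.

Lemma linf_normZ (a : R[i]) f : linf_norm (a *: f) = cmod a * linf_norm f.
Proof. by apply: complexI; rewrite rmorphM/= linf_normrZ. Qed.

Lemma linf_normN f : linf_norm (- f) = linf_norm f.
Proof. by rewrite -scaleN1r linf_normZ cmodN cmod1 mul1r. Qed.

Lemma linf_norm_eq0 f : linf_norm f <= 0 -> f = 0.
Proof.
move=> f0; apply: linf_norm0_eq0; congr _%:C.
by apply/eqP; rewrite eq_le f0 linf_norm_ge0.
Qed.

(** Completeness with a rate: the limit is taken pointwise with error [e n *+ 2] divided by [u x],
    which becomes uniform in the weighted norm. *)
Lemma linf_cvg_steps (v : nat -> linf u) (e : nat -> R) :
  (forall n, linf_norm (v n.+1 - v n) <= e n - e n.+1) -> e @ \oo --> 0 ->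
  exists l, forall n, linf_norm (l - v n) <= e n *+ 2.
Proof.
move=> ve e0.
have /choice[l lP] x : exists y, forall n,
    (u x)%:num * cmod (y - v n x) <= e n *+ 2.
  have [||y yP] := @cmod_cvg_steps _ (fun n => v n x)
      (fun n => (u x)%:num^-1 * e n).
  - move=> n; rewrite -mulrBr ler_pdivlMl//; apply: le_trans (ve n).
    exact: (linf_norm_ub (v n.+1 - v n) x).
  - by rewrite -[X in _ --> X](mulr0 ((u x)%:num^-1)); apply: cvgMr.
  - by exists y => n; rewrite -ler_pdivlMl// mulrnAr.
have e_ge0 n : 0 <= e n.
  apply: nonincreasing_cvg0_ge0 e0 n; apply/nonincreasing_seqP => k.
  by rewrite -subr_ge0; exact: le_trans (linf_norm_ge0 _) (ve k).
have lfin : l \in wsup_finite u.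
  apply/wsup_finiteP; exists (e 0%N *+ 2 + linf_norm (v 0%N)) => x.
  apply: le_trans (lerD (lP x 0%N) (linf_norm_ub (v 0%N) x)).
  rewrite -mulrDr ler_wpM2l//; apply: le_trans (cmodD _ _).
  by rewrite subrK.
exists (Linf lfin) => n; apply: linf_norm_le => [|x]; last exact: lP.
by rewrite mulrn_wge0.
Qed.

Variables (T : {linear linf u -> linf u}) (k : R).
Hypotheses (k0 : 0 <= k) (Tk : forall f, linf_norm (T f) <= k * linf_norm f).

Lemma contraction_sub_inj (l : R[i]) f :
  k < cmod l -> T f - l *: f = 0 -> f = 0.
Proof.
move=> kl /eqP; rewrite subr_eq0 => /eqP Tf; apply: linf_norm_eq0.
have := Tk f; rewrite Tf linf_normZ => h.
have := linf_norm_ge0 f; rewrite le_eqVlt => /predU1P[<-//|f0].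
by move: h; rewrite ler_pM2r// leNgt kl.
Qed.

(** A solution is a fixed point of [S f = l^-1 *: (T f - g)], a contraction of ratio [k / cmod l];
    it is found by iterating [S] from 0. *)
Lemma contraction_sub_surj (l : R[i]) g : k < cmod l ->
  exists f, T f - l *: f = g.
Proof.
move=> kl; have l0 : 0 < cmod l by exact: le_lt_trans kl.
have lN0 : l != 0 by apply: contraTneq l0 => ->; rewrite cmod0 ltxx.
pose q := k / cmod l.
have q0 : 0 <= q by rewrite divr_ge0// cmod_ge0.
have q1 : q < 1 by rewrite ltr_pdivrMr// mul1r.
have q1' : 1 - q != 0 by rewrite subr_eq0 gt_eqF.
pose S f := l^-1 *: (T f - g).
have SB f f' : linf_norm (S f - S f') <= q * linf_norm (f - f').
  rewrite /S -scalerBr opprB addrA subrK -raddfB linf_normZ.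
  rewrite ComplexField.Normc.normcV [leLHS]mulrC /q mulrAC.
  by apply: ler_wpM2r (Tk _); rewrite invr_ge0 cmod_ge0.
pose v n := iter n S 0.
pose D := linf_norm (v 1%N) / (1 - q).
have [||f fP] := @linf_cvg_steps v (fun n => D * q ^+ n).
- move=> n; apply: (@le_trans _ _ (linf_norm (v 1%N) * q ^+ n)); last first.
    by rewrite exprS mulrA -mulrBl -[X in X - _]mulr1 -mulrBr mulfVK.
  elim: n => [|n ih]; first by rewrite subr0 mulr1.
  by rewrite exprS mulrCA; apply: le_trans (SB _ _) _; rewrite ler_wpM2l.
- exact: cvg_geo.
exists f.
have Sf : f - S f = 0.
  (* Insert [v n.+1 = S (v n)]: the distances from [f] to [v n.+1] and from [S (v n)] to [S f] are
     each at most [D *+ 2 * q ^+ n]. *)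
  apply: linf_norm_eq0; apply: (@le_geo0 _ _ _ (D *+ 4) q) => // n.
  rewrite add0r -[f - S f](subrKA (v n.+1)).
  apply: le_trans (linf_normD _ _) _.
  rewrite (mulrnDr D 2 2) mulrDl; apply: lerD.
    apply: le_trans (fP n.+1) _; rewrite -mulrnAl ler_wpM2l//.
      by rewrite mulrn_wge0// divr_ge0 ?linf_norm_ge0// subr_ge0 ltW.
    by rewrite exprS ler_piMl ?exprn_ge0// ltW.
  apply: le_trans (SB _ _) _; rewrite -linf_normN opprB.
  rewrite mulrnAl; apply: le_trans (fP n).
  by rewrite ler_piMl ?linf_norm_ge0// ltW.
have : l *: (f - S f) = 0 by rewrite Sf scaler0.
rewrite scalerBr /S scalerA divff// scale1r => /subr0_eq ->.
by rewrite opprB addrCA subrr addr0.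
Qed.

(** The operator is bijective: its kernel is 0 and its range is everything, so empty families
    witness both finiteness conditions. *)
Lemma contraction_fredholm (l : R[i]) : k < cmod l ->
  fredholm (fun f => T f - l *: f).
Proof.
move=> kl; have surj := contraction_sub_surj _ kl.
have rT : range (fun f => T f - l *: f) = setT.
  by apply/seteqP; split=> // g _; have [f fg] := surj g; exists f.
split.
- exists 0%N, (fun=> 0); split=> [[]//|f /= /contraction_sub_inj ->//].
  by exists (fun=> 0); rewrite big_ord0.
- rewrite rT; exact: closedT.
- exists 0%N, (fun=> 0) => f; exists (fun=> 0), f.
  by rewrite rT big_ord0 addr0.
Qed.

Lemma contraction_ess_spectral_radius : (ess_spectral_radius T <= k%:E)%E.
Proof.
rewrite /ess_spectral_radius ge_max lee_fin k0/=.
apply: ge_ereal_sup => _ [l /= lT <-]; rewrite lee_fin leNgt.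
by apply/negP => kl; apply: lT; exact: contraction_fredholm.
Qed.

Lemma contraction_bounded : bounded_operator T.
Proof. by exists k => f; rewrite !linf_normE -rmorphM lecR. Qed.

End LinfContraction.

(** * The transfer operator *)

Section TransferBound.
Context {R : realType} (G : growth_system R) (theta kappa : {posnum R}).
Local Notation w := (ell1_weight (G := G) theta kappa).
Local Notation u := (sup_weight (G := G) theta kappa).

Lemma sup_weightE x : (u x)%:num = (w x)%:num^-1.
Proof. by rewrite /= invfM. Qed.

(** The length part uses [(s + 1)^2 = s^2 + 2 s + 1]; the [theta] part cannot grow, since complexity
    does not decrease under extension. *)
Lemma ell1_weight_ext_le x (r : gs_adm x) : theta%:num <= 1 ->
  (w (gs_ext r))%:num <= kappa%:num ^+ ((gs_len x).*2.+1) * (w x)%:num.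
Proof.
move=> t1 /=; rewrite mulrCA ler_pM ?exprn_ge0//.
  by apply: ler_wiXn2l => //; exact: gs_rv3.
rewrite gs_rv2 -exprD.
have -> // : ((gs_len x).+1 ^ 2 = (gs_len x).*2.+1 + gs_len x ^ 2)%N.
by rewrite -!mulnn mulSn mulnS -addnn addnA addSn.
Qed.

(** The two weights are reciprocal, so each value of [f] is at most [linf_norm f] times the
    [ell1_weight] there; summing over extensions brings in the hypothesis on weights. *)
Lemma transfer_sup_le (z : R[i]) (f : Bspace G theta kappa) (k : R) :
  0 <= k -> cmod z <= 1 ->
  (forall x, \sum_(r : gs_adm x) (w (gs_ext r))%:num <= k * (w x)%:num) ->
  forall x, (u x)%:num * cmod (transfer z f x) <= k * linf_norm f.
Proof.
move=> k0 z1 wk x; rewrite sup_weightE ler_pdivrMl//.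
rewrite cmodM.
apply: le_trans (_ : cmod (\sum_(r : gs_adm x) f (gs_ext r)) <= _).
  by rewrite ler_piMl ?cmod_ge0.
apply: le_trans (ler_cmod_sum _ _ _) _.
rewrite mulrA mulrC [X in _ * X]mulrC.
apply: le_trans (ler_wpM2l (linf_norm_ge0 f) (wk x)).
rewrite mulr_sumr; apply: ler_sum => r _.
by have := linf_norm_ub f (gs_ext r); rewrite sup_weightE ler_pdivrMl// mulrC.
Qed.

Lemma transfer_operator (z : R[i]) (k : R) :
  0 <= k -> cmod z <= 1 ->
  (forall x, \sum_(r : gs_adm x) (w (gs_ext r))%:num <= k * (w x)%:num) ->
  exists T : {linear Bspace G theta kappa -> Bspace G theta kappa},
    (forall f x, T f x = transfer z f x) /\
    (forall f, linf_norm (T f) <= k * linf_norm f).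
Proof.
move=> k0 z1 wk.
have Tfin (f : Bspace G theta kappa) : transfer z f \in wsup_finite u.
  apply/wsup_finiteP; exists (k * linf_norm f); exact: transfer_sup_le.
pose T0 (f : Bspace G theta kappa) : Bspace G theta kappa := Linf (Tfin f).
have T0lin : linear T0.
  move=> a f g; apply/val_inj/funext => x /=.
  rewrite /transfer big_split/= -scaler_sumr mulrDr; congr (_ + _).
  by rewrite mulrCA.
pose T : {linear Bspace G theta kappa -> Bspace G theta kappa} :=
  HB.pack T0 (GRing.isLinear.Build _ _ _ _ T0 T0lin).
exists T; split=> // f; apply: linf_norm_le.
  by rewrite mulr_ge0// linf_norm_ge0.
exact: transfer_sup_le.
Qed.

End TransferBound.

(** With [s] the length of [x], there are at most [(C0 + C1) (s + 1)] extensions, each of relative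
    weight at most [kappa * kappa^(2 s)]. Since [s + 1 <= 2^s] and [kappa <= 1/2],
    [(s + 1) kappa^(2 s) <= 1], which leaves [(C0 + C1) kappa]. *)
Lemma sum_ell1_weight_ext_le (R : realType) (G : growth_system R)
    (theta kappa : {posnum R}) (C0 C1 : R) :
  0 <= C0 -> 0 <= C1 ->
  (forall x : gs_state G, #|gs_adm x|%:R <= C0 + C1 * (gs_len x)%:R) ->
  theta%:num <= 1 -> kappa%:num <= 2^-1 -> (C0 + C1) * kappa%:num <= 2^-1 ->
  forall x,
    \sum_(r : gs_adm x) (ell1_weight (G := G) theta kappa (gs_ext r))%:num
    <= 2^-1 * (ell1_weight (G := G) theta kappa x)%:num.
Proof.
move=> C00 C10 AC t1 k2 Ck x.
have : 0 <= (ell1_weight theta kappa x)%:num by [].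
set wx := (ell1_weight _ _ x)%:num => wx0.
apply: (@le_trans _ _
  (\sum_(r : gs_adm x) kappa%:num ^+ (gs_len x).*2.+1 * wx)).
  by apply: ler_sum => r _; exact: ell1_weight_ext_le.
rewrite sumr_const -[_ *+ #|_|]mulr_natl mulrA; apply: ler_wpM2r => //.
set s := gs_len x.
have sC : #|gs_adm x|%:R <= (C0 + C1) * s.+1%:R.
  apply: le_trans (AC x) _; rewrite -/s -natr1 mulrDr mulr1 mulrDl.
  by have := mulr_ge0 C00 (ler0n R s); lra.
have ks : s.+1%:R * kappa%:num ^+ s.*2 <= 1.
  apply: (@le_trans _ _ ((2 ^ s)%N%:R * 2^-1 ^+ s)).
    apply: ler_pM => //.
      by rewrite ler_nat ltn_expl.
    rewrite -addnn exprD; apply: le_trans (_ : kappa%:num ^+ s <= _).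
      by rewrite ler_piMl ?exprn_ge0// exprn_ile1//; lra.
    by rewrite lerXn2r ?nnegrE.
  by rewrite natrX -exprMn divff ?expr1n// pnatr_eq0.
rewrite exprS; apply: le_trans Ck.
apply: le_trans (ler_wpM2r _ sC) _; first by rewrite mulr_ge0// exprn_ge0.
rewrite mulrACA ler_piMr// mulr_ge0// addr_ge0//.
Qed.
(** * Unordered sums and the adjoint *)

Section Exhaustion.
Context {R : realType} {X : choiceType} (E : nat -> {fset X}).
Hypothesis E_mono : forall m n, (m <= n)%N -> (E m `<=` E n)%fset.
Hypothesis E_cover : forall x, exists n, x \in E n.

Lemma fset_exhausted (B : {fset X}) m :
  exists2 n, (m <= n)%N & (B `<=` E n)%fset.
Proof.
have /choice[i iE] := E_cover.
exists (maxn m (\max_(x <- B) i x)); first exact: leq_maxl.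
apply/fsubsetP => x xB; apply: (fsubsetP (E_mono _)) (iE x).
by apply: leq_trans (leq_maxr _ _); apply: leq_bigmax_seq.
Qed.

Lemma sum_fset_diff (V : zmodType) (F : X -> V) (A B : {fset X}) :
  (A `<=` B)%fset ->
  \sum_(x <- B) F x - \sum_(x <- A) F x = \sum_(x <- (B `\` A)%fset) F x.
Proof.
move=> AB; rewrite (big_fsetID _ (mem A) B)/=.
have -> : [fset x in B | x \in A]%fset = A.
  apply/fsetP => x; rewrite !inE/= andbC; apply: andb_idr => xA.
  exact: (fsubsetP AB).
rewrite addrAC subrr add0r; congr (\sum_(x <- _) _); apply: congr1.
by apply/fsetP => x; rewrite !inE/= andbC.
Qed.

Lemma ler_sum_fset (F : X -> R) (A B : {fset X}) : (forall x, 0 <= F x) ->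
  (A `<=` B)%fset -> \sum_(x <- A) F x <= \sum_(x <- B) F x.
Proof.
by move=> F0 AB; rewrite -subr_ge0 sum_fset_diff// sumr_ge0.
Qed.

Lemma cmod_sum_fset_diff (g : X -> R[i]) (A B : {fset X}) : (A `<=` B)%fset ->
  cmod (\sum_(x <- B) g x - \sum_(x <- A) g x) <=
  \sum_(x <- B) cmod (g x) - \sum_(x <- A) cmod (g x).
Proof. by move=> AB; rewrite !sum_fset_diff//; exact: ler_cmod_sum. Qed.

(** Absolute summability reduces the limit over all finite subsets to one along the sequence [E]: a
    finite set containing [E n] lies in some [E m], so its sum differs from that over [E n] by at
    most the absolute tail [e n]. *)
Lemma cvg_sum_exhaustion (g : X -> R[i]) (M : R) :
  (forall n, \sum_(x <- E n) cmod (g x) <= M) ->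
  (fun n => \sum_(x <- E n) g x) @ \oo --> (summability.sum g : R[i]).
Proof.
move=> gM; pose a n := \sum_(x <- E n) cmod (g x).
have a_mono : nondecreasing_seq a.
  move=> m n mn; apply: ler_sum_fset; last exact: E_mono.
  by move=> x; exact: cmod_ge0.
have cva : cvgn a.
  by apply: nondecreasing_is_cvgn => //; exists M => _ [n _ <-]; exact: gM.
pose e n := limn a - a n.
have e0 : e @ \oo --> 0.
  rewrite -[X in _ --> X](subrr (limn a)); apply: cvgB => //; exact: cvg_cst.
have [|l lP] := @cmod_cvg_steps R (fun n => \sum_(x <- E n) g x) e _ e0.
  move=> n; apply: le_trans (cmod_sum_fset_diff _ (E_mono (leqnSn n))) _.
  by rewrite /e /a; lra.
(* Of the three copies of [e n], two bound the distance from the sum over [E n] to [l], and one the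
   passage from [E n] to a larger finite set. *)
have small d : 0 < d -> \forall n \near \oo, e n *+ 3 <= d.
  move=> d0; have d3 : 0 < d / 3 by rewrite divr_gt0.
  have /cvgrPdist_le/(_ _ d3) := e0; apply: filterS => n.
  by rewrite sub0r normrN => /(le_trans (ler_norm _)); rewrite -mulr_natr; lra.
have e_ge0 n : 0 <= e n by rewrite subr_ge0; exact: nondecreasing_cvgn_le.
suff -> : (summability.sum g : R[i]) = l.
  apply: cvg_cmod => d /small; apply: filterS => n.
  rewrite cmodB => end_; apply: le_trans (lP n) (le_trans _ end_).
  by rewrite ler_wpMn2l.
have FF := @summability.totally_filter X.
apply: cvg_lim; first exact: norm_hausdorff.
apply: cvg_cmod => d /small[n _ /(_ n (leqnn n)) /= nd].
exists (E n) => // B /= nB.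
rewrite /summability.partial_sum -(big_seq_fsetE _ B xpredT).
have [m nm Bm] := fset_exhausted B n.
rewrite -[X in X - l](subrK (\sum_(x <- E n) g x)) -addrA.
apply: le_trans (cmodD _ _) (le_trans _ nd); rewrite mulrS lerD//; last first.
  by rewrite cmodB.
apply: le_trans (cmod_sum_fset_diff _ nB) _; rewrite lerD2r.
apply: (@le_trans _ _ (a m)); last exact: nondecreasing_cvgn_le.
by apply: ler_sum_fset => // x; exact: cmod_ge0.
Qed.

Variable w : X -> {posnum R}.

Lemma wsum_le_exhaustion (f : X -> R[i]) (M : R) :
  (forall n, \sum_(x <- E n) cmod (f x) * (w x)%:num <= M) ->
  (wsum w f <= M%:E)%E.
Proof.
move=> fM; apply: ge_ereal_sup => _ [F [finF _] <-].
rewrite fsbig_finite// sumEFin lee_fin.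
have [n _ Fn] := fset_exhausted (fset_set F) 0.
apply: le_trans (fM n); apply: ler_sum_fset => // x.
by rewrite mulr_ge0// cmod_ge0.
Qed.

Lemma sum_fset_le_ell1_norm (mu : ell1 w) (A : {fset X}) :
  \sum_(x <- A) cmod (mu x) * (w x)%:num <= ell1_norm mu.
Proof.
rewrite -lee_fin ell1_normE; apply: esum_ge; exists [set` A].
  by split => //; exact: finite_fset.
by rewrite fsbig_finite ?finite_fset// set_fsetK sumEFin.
Qed.

End Exhaustion.

(** * The adjoint as a push-forward along extensions *)

Section Adjoint.
Context {R : realType} (G : growth_system R).
Local Notation X := (gs_state G).

Definition len_ball (n : nat) : {fset X} :=
  fset_set [set x | (gs_len x <= n)%N].

Lemma in_len_ball n x : (x \in len_ball n) = (gs_len x <= n)%N.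
Proof.
rewrite in_fset_set; last exact: gs_rv1.
by apply/idP/idP; rewrite inE.
Qed.

Lemma len_ball_mono m n : (m <= n)%N -> (len_ball m `<=` len_ball n)%fset.
Proof.
move=> mn; apply/fsubsetP => x; rewrite !in_len_ball => h; exact: leq_trans mn.
Qed.

Lemma len_ball_cover x : exists n, x \in len_ball n.
Proof. by exists (gs_len x); rewrite in_len_ball. Qed.

(* An [x] with an extension equal to [y] has length [(gs_len y).-1]; at length
   [0] no [r] qualifies and the sum is [0]. *)
Definition push (K : pzRingType) (mu : X -> K) (y : X) : K :=
  \sum_(x <- len_ball (gs_len y).-1) \sum_(r : gs_adm x | gs_ext r == y) mu x.

(** Duality on finite balls, by exchanging sums: extension raises length by exactly 1, so the ball
    of radius [n.+1] receives mass only from the ball of radius [n], and receives all of it. The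
    ring is general so as to cover both complex values and real moduli with weights. *)
Lemma sum_push (K : pzRingType) (mu f : X -> K) n :
  \sum_(y <- len_ball n.+1) push mu y * f y =
  \sum_(x <- len_ball n) mu x * \sum_(r : gs_adm x) f (gs_ext r).
Proof.
transitivity (\sum_(y <- len_ball n.+1) \sum_(x <- len_ball n)
   \sum_(r : gs_adm x) if gs_ext r == y then mu x * f y else 0).
  rewrite big_seq [RHS]big_seq; apply: eq_bigr => y; rewrite in_len_ball => yn.
  rewrite /push (@big_fset_incl _ _ _ _ _ (len_ball n)).
  - rewrite mulr_suml; apply: eq_bigr => x _.
    by rewrite mulr_suml big_mkcond.
  - by apply: len_ball_mono; case: (gs_len y) yn.
  - move=> x _; rewrite in_len_ball => xy; apply: big1 => r /eqP ry.
    by move: xy; rewrite -ry gs_rv2 leqnn.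
rewrite exchange_big/= big_seq [RHS]big_seq; apply: eq_bigr => x.
rewrite in_len_ball => xn; rewrite exchange_big/= mulr_sumr.
apply: eq_bigr => r _.
rewrite (bigD1_seq (gs_ext r)) ?fset_uniq ?in_len_ball ?gs_rv2//= eqxx.
by rewrite big1 ?addr0// => y; rewrite eq_sym => /negPf ->.
Qed.

Lemma cmod_push (mu : X -> R[i]) y :
  cmod (push mu y) <= push (fun x => cmod (mu x)) y.
Proof.
apply: le_trans (ler_cmod_sum _ _ _) _; apply: ler_sum => x _.
exact: ler_cmod_sum.
Qed.

Lemma len_ball0_push (K : pzRingType) (mu : X -> K) y :
  y \in len_ball 0 -> push mu y = 0.
Proof.
rewrite in_len_ball leqn0 => /eqP y0; apply: big1 => x _; apply: big1 => r /eqP.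
by move=> ry; move: y0; rewrite -ry gs_rv2.
Qed.

Variables (theta kappa : {posnum R}) (k : R).
Local Notation w := (ell1_weight (G := G) theta kappa).
Hypothesis k0 : 0 <= k.
Hypothesis wk : forall x,
  \sum_(r : gs_adm x) (w (gs_ext r))%:num <= k * (w x)%:num.

Lemma push_wsum_le (mu : L1space G theta kappa) :
  (wsum w (push mu) <= (k * ell1_norm mu)%:E)%E.
Proof.
apply: (wsum_le_exhaustion len_ball_mono len_ball_cover) => -[|n].
  (* [sum_push] treats radii [n.+1] only; on the ball of radius 0 [push mu] vanishes. *)
  rewrite big_seq big1 ?mulr_ge0 ?ell1_norm_ge0// => y /len_ball0_push ->.
  by rewrite cmod0 mul0r.
apply: (@le_trans _ _ (\sum_(y <- len_ball n.+1)
    push (fun x => cmod (mu x)) y * (w y)%:num)).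
  by apply: ler_sum => y _; rewrite ler_wpM2r// cmod_push.
rewrite sum_push.
apply: le_trans (ler_wpM2l k0 (sum_fset_le_ell1_norm mu (len_ball n))).
rewrite mulr_sumr; apply: ler_sum => x _.
by rewrite mulrCA ler_wpM2l ?cmod_ge0.
Qed.

Lemma push_wsum_finite (mu : L1space G theta kappa) :
  push mu \in wsum_finite w.
Proof. by rewrite inE/=; apply: le_lt_trans (push_wsum_le mu) (ltry _). Qed.

Definition push_op (mu : L1space G theta kappa) : L1space G theta kappa :=
  Ell1 (push_wsum_finite mu).

Lemma push_op_norm mu : ell1_norm (push_op mu) <= k * ell1_norm mu.
Proof. by rewrite -lee_fin ell1_normE; exact: push_wsum_le. Qed.

(** As the weights are reciprocal, the product of the two norms bounds all absolute partial sums,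
    and the unordered sum can be computed along balls. *)
Lemma cvg_pairing (mu : L1space G theta kappa) (f : Bspace G theta kappa) :
  (fun n => \sum_(x <- len_ball n) mu x * f x) @ \oo --> pairing mu f.
Proof.
apply: (@cvg_sum_exhaustion _ _ _ len_ball_mono len_ball_cover _
  (linf_norm f * ell1_norm mu)) => n.
apply: le_trans (ler_wpM2l (linf_norm_ge0 f)
  (sum_fset_le_ell1_norm mu (len_ball n))).
rewrite mulr_sumr; apply: ler_sum => x _.
rewrite cmodM mulrCA ler_wpM2l ?cmod_ge0//.
by have := linf_norm_ub f x; rewrite sup_weightE ler_pdivrMl// mulrC.
Qed.

Lemma push_op_adjoint : is_adjoint push_op.
Proof.
move=> mu f _.
(* [T f] presents [transfer 1 f] as an element of [Bspace], so that [cvg_pairing] applies to it. The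
   balls on the two sides differ by one in radius, hence the shift. *)
have [|T [TE _]] := @transfer_operator _ G theta kappa 1 k k0 _ wk.
  by rewrite cmod1.
have <- : T f = transfer 1 f :> (X -> R[i]) by apply/funext => x.
have := @cvg_pairing (push_op mu) f; rewrite -cvg_shiftS => muf.
rewrite -(cvg_lim (@norm_hausdorff _ R[i]) muf).
rewrite -(cvg_lim (@norm_hausdorff _ R[i]) (@cvg_pairing mu (T f))).
congr (lim (_ @ \oo)); apply/funext => n /=; rewrite sum_push.
by apply: eq_bigr => x _; rewrite TE /transfer mul1r.
Qed.

Lemma dirac_wsup_finite (y : X) : (fun x => (x == y)%:R : R[i]) \in
  wsup_finite (sup_weight (G := G) theta kappa).
Proof.
apply/wsup_finiteP; exists ((sup_weight theta kappa y)%:num) => x.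
by case: eqP => [->|_]; rewrite ?cmod1 ?mulr1// cmod0 mulr0.
Qed.

Definition dirac_fun (y : X) : Bspace G theta kappa :=
  Linf (dirac_wsup_finite y).

Lemma dirac_fun_Bspace0 y : Bspace0 (dirac_fun y).
Proof.
move=> e e0; exists (gs_len y).+1 => x xy /=.
by case: eqP xy => [->|_ _]; rewrite ?ltnn// cmod0 mulr0.
Qed.

Lemma pairing_dirac (mu : L1space G theta kappa) y :
  pairing mu (dirac_fun y) = mu y.
Proof.
rewrite -(cvg_lim (@norm_hausdorff _ R[i]) (@cvg_pairing mu (dirac_fun y))).
apply: cvg_lim; first exact: norm_hausdorff.
apply: cvg_near_cst; exists (gs_len y) => // n /= yn.
rewrite (bigD1_seq y) ?fset_uniq ?in_len_ball//= eqxx mulr1 big1 ?addr0//.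
by move=> x /negPf ->; rewrite mulr0.
Qed.

(* The functions [dirac_fun y] separate the points of [ell1]. *)
Lemma adjoint_unique (T : L1space G theta kappa -> L1space G theta kappa) :
  is_adjoint T -> T =1 push_op.
Proof.
move=> Tadj mu; apply/val_inj/funext => y /=.
rewrite -[LHS](pairing_dirac (T mu)) Tadj; last exact: dirac_fun_Bspace0.
rewrite -(push_op_adjoint mu); last exact: dirac_fun_Bspace0.
exact: pairing_dirac.
Qed.

Lemma adjoint_iter_norm (T : L1space G theta kappa -> L1space G theta kappa)
    mu n : is_adjoint T -> ell1_norm (iter n T mu) <= ell1_norm mu * k ^+ n.
Proof.
move=> /adjoint_unique TE; elim: n => [|n ih]; first by rewrite mulr1.
rewrite iterS TE exprS mulrCA; apply: le_trans (push_op_norm _) _.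
by rewrite ler_wpM2l.
Qed.

End Adjoint.

(** * Continuous functionals and the choice of parameters *)

Lemma ell1_functional_bounded (R : realType) (X : choiceType)
    (w : X -> {posnum R}) (Lambda : {linear ell1 w -> R[i]}) :
  continuous Lambda ->
  exists K : R, forall mu, cmod (Lambda mu) <= K * ell1_norm mu.
Proof.
move=> /linear_bounded_continuous/linear_boundedP[M [Mreal MP]].
(* Boundedness yields a complex [M] that is real, and every scalar strictly above it is a bound. *)
exists (cmod M + 1) => mu; rewrite -lecR rmorphM.
apply: (MP (cmod M + 1)%:C).
rewrite rmorphD/= -cmod_normE; apply: le_lt_trans (real_ler_norm Mreal) _.
by rewrite ltrDl ltr01.
Qed.

Theorem theorem4p10 (R : realType) (G : growth_system R) :
  exists (theta kappa : {posnum R}) (rho : R),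
    [/\ theta%:num < 1, kappa%:num < 1, 0 < rho,
      forall z : R[i], `|z| <= 1 ->
        exists T : {linear Bspace G theta kappa -> Bspace G theta kappa},
          [/\ forall f x, T f x = transfer z f x,
              bounded_operator T & quasi_compact T]
    & (exists Tadj : L1space G theta kappa -> L1space G theta kappa,
        is_adjoint Tadj) /\
      (forall Tadj : L1space G theta kappa -> L1space G theta kappa,
        is_adjoint Tadj ->
        forall Lambda : {linear L1space G theta kappa -> R[i]},
          continuous Lambda ->
          let c n := Lambda (iter n Tadj (dirac_mass _ (gs_root G))) in
          [/\ (0%:E < convergence_radius c)%E,
              forall z : R[i], `|z| < rho%:C -> cvgn (power_series c z)
            & analytic_on [set z | `|z| < rho%:C] (power_series_sum c)])].
Proof.
have [C0 [C1 [C00 C10 AC]]] := gs_rv4 G.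
have half0 : 0 <= (2^-1 : R) by [].
have half1 : (2^-1 : R) < 1 by lra.
(* This value of [kappa] makes both [kappa] and [(C0 + C1) * kappa] at most [1/2]; the summand 1
   keeps the denominator positive when both constants are 0. *)
have kap0 : 0 < (2 * (1 + C0 + C1))^-1 by rewrite invr_gt0; lra.
have kapE : (2 * (1 + C0 + C1))^-1 * (2 * (1 + C0 + C1)) = 1.
  by rewrite mulVf// gt_eqF//; lra.
have half_gt0 : 0 < (2^-1 : R) by [].
pose theta : {posnum R} := PosNum half_gt0.
pose kappa : {posnum R} := PosNum kap0.
have kC0 := mulr_ge0 (ltW kap0) C00; have kC1 := mulr_ge0 (ltW kap0) C10.
have wk : forall x : gs_state G, \sum_(r : gs_adm x)
    (ell1_weight theta kappa (gs_ext r))%:num <=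
    2^-1 * (ell1_weight theta kappa x)%:num.
  apply: (sum_ell1_weight_ext_le C00 C10 AC) => /=; lra.
exists theta, kappa, 1; split => //=; first lra.
- move=> z; rewrite cmod_normE -(rmorph1 (real_complex R)) lecR => z1.
  have [T [TE Tk]] := transfer_operator half0 z1 wk.
  exists T; split => //; first exact: contraction_bounded Tk.
  apply: le_lt_trans (contraction_ess_spectral_radius half0 Tk) _.
  by rewrite lte_fin.
split; first by exists (push_op half0 wk); exact: push_op_adjoint.
move=> T Tadj Lambda /ell1_functional_bounded[K LK] /=.
set c := fun n => Lambda (iter n T (dirac_mass _ (gs_root G))).
pose C := `|K| * ell1_norm (dirac_mass (ell1_weight theta kappa) (gs_root G)).
have cC n : cmod (c n) <= C * 2^-1 ^+ n.
  apply: le_trans (LK _) _; rewrite /C -mulrA.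
  apply: le_trans (ler_wpM2l (normr_ge0 K)
    (adjoint_iter_norm half0 wk (dirac_mass _ (gs_root G)) n Tadj)).
  by rewrite ler_wpM2r ?ell1_norm_ge0// ler_norm.
have cv z : cmod z < 1 -> cvgn (power_series c z).
  move=> z1; have [|l lP] := @power_series_cvg _ c z C 2^-1 half0 half1.
    move=> n; rewrite cmodM cmodX; apply: le_trans (cC n).
    apply: ler_piMr; first exact: cmod_ge0.
    by rewrite exprn_ile1 ?cmod_ge0// ltW.
  by apply/cvg_ex; exists l; exact: cvg_cmod_geo lP.
have ltC1 (z : R[i]) : (`|z| < 1%:C) = (cmod z < 1) by rewrite cmod_normE ltcR.
split.
(* Any nonzero point of the open unit disc would witness a positive radius; [1/2] is one. *)
- apply: (@lt_le_trans _ _ (2^-1)%:E); first by rewrite lte_fin; lra.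
  apply: ereal_sup_ubound; exists (2^-1)%:C.
    by apply: cv; rewrite cmod_real ger0_norm.
  by rewrite cmod_real ger0_norm.
- by move=> z; rewrite ltC1; exact: cv.
- move=> z0; rewrite /= ltC1 => z01.
  (* The largest radius that [power_series_recenter] allows at [z0]. *)
  have r0 : 0 < 1 - cmod z0 by rewrite subr_gt0.
  have [|a aP] := power_series_recenter cC r0 (z0 := z0); first by lra.
  exists a, (1 - cmod z0); split=> // z; rewrite cmod_normE ltcR => zr.
  by rewrite -[X in power_series_sum c X](subrKC z0 z); exact: aP.
Qed.
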